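(* Let $M\in\mathbb{R}^{m\times n}$ and $S\in\mathbb{R}^{d\times m}$ with $n\le d\le m$, and let $c=\kappa(S\,|\,\mathrm{range}(M))$ be finite; let $k=\mathrm{rank}(SM)=\mathrm{rank}(M)$. If $\mathtt{qrcp}$ satisfies the RRQR property for $SM$ with coefficients $(f_\ell)_{\ell=1}^k$, then $\mathtt{cqrrpt\_core}(\cdot,S)$ (which uses $\mathtt{qrcp}$ as its subroutine) satisfies the RRQR property for $M$ with coefficients $(c f_\ell)_{\ell=1}^k$.
   Context: All matrices are real, $X^*$ denotes the transpose, arithmetic is exact, and singular values are in decreasing order. ''Orthonormal matrix'' means a matrix with orthonormal columns. Restricted condition number: for a linear subspace $L\subset\mathbb{R}^m$ and any orthonormal matrix $U$ with range $L$, $\kappa(S|L)$ is the ratio of the largest to the smallest singular value of $SU$ (infinite if the smallest is zero). Column-pivoted QR decomposition: for a rank-$k$ matrix $X$ with $n$ columns, it consists of an orthonormal $Q$, an upper-trapezoidal $R$, and a permutation vector $J$ of $\{1,\dots,n\}$ such that $X[:,J]=Q_kR_k$, with $Q_k$ the first $k$ columns of $Q$ and $R_k$ the first $k$ rows of $R$. A QRCP algorithm (such as $\mathtt{qrcp}$ or $\mathtt{cqrrpt\_core}(\cdot,S)$) returns such $[Q,R,J]$; below, $R$ is taken with $k$ rows. Blocks: for a $k\times n$ upper-trapezoidal $R$ and $\ell\le k$, $A_\ell=R[1{:}\ell,1{:}\ell]$, $B_\ell=R[1{:}\ell,\ell{+}1{:}n]$, $C_\ell=R[\ell{+}1{:}k,\ell{+}1{:}n]$.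 RRQR property: let $X$ have $n$ columns, at least as many rows, and rank $k$, and let $f_1,\dots,f_k\ge 1$. A QRCP algorithm has the RRQR property for $X$ with coefficients $(f_\ell)_{\ell=1}^k$ if the R-factor it returns for $X$ satisfies, for all $\ell\le k$, $$\sigma_j(A_\ell)\ge \frac{\sigma_j(X)}{f_\ell}\ \text{ for all } j\le \ell,\qquad \sigma_j(C_\ell)\le f_\ell\,\sigma_{\ell+j}(X)\ \text{ for all } j\le k-\ell.$$ Algorithm $\mathtt{cqrrpt\_core}(M,S)$: (1) $M^{\mathrm{sk}}=SM$; (2) $[Q^{\mathrm{sk}},R^{\mathrm{sk}},J]=\mathtt{qrcp}(M^{\mathrm{sk}})$; (3) $k=\mathrm{rank}(R^{\mathrm{sk}})$; (4) $M^{\mathrm{pre}}=M[:,J[1{:}k]]\,(R^{\mathrm{sk}}[1{:}k,1{:}k])^{-1}$; (5) $G=(M^{\mathrm{pre}})^*M^{\mathrm{pre}}$; (6) $R^{\mathrm{pre}}=\mathtt{chol}(G)$, the upper-triangular Cholesky factor with $G=(R^{\mathrm{pre}})^*R^{\mathrm{pre}}$; (7) $Q_k=M^{\mathrm{pre}}(R^{\mathrm{pre}})^{-1}$; (8) $R_k=R^{\mathrm{pre}}R^{\mathrm{sk}}[1{:}k,:]$; return $Q_k,R_k,J$. *)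

(* Defs.v *)
From mathcomp Require Import all_boot all_order all_algebra all_fingroup.
From mathcomp Require Import polyrcf.
From mathcomp Require Import boolp classical_sets reals constructive_ereal.

Set Implicit Arguments.
Unset Strict Implicit.
Unset Printing Implicit Defensive.

Import Order.TTheory GRing.Theory Num.Theory.
Local Open Scope ring_scope.

Section SingularValues.
Variable R : realType.

(* Real eigenvalues, repeated according to algebraic multiplicity. *)
Definition eigenvalues n (A : 'M[R]_n) : seq R :=
  let p := char_poly A in flatten [seq nseq (mup a p) a | a <- rootsR p].

(* X^T *m X is symmetric, hence its characteristic polynomial splits over R and
   this sequence has length n.  When n > m, the n - m last values are 0. *)
Definition singular_values m n (X : 'M[R]_(m, n)) : seq R :=
  sort >=%R [seq Num.sqrt a | a <- eigenvalues (X^T *m X)].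

(* Indices start at 1. *)
Definition sigma m n (j : nat) (X : 'M[R]_(m, n)) : R :=
  (singular_values X)`_j.-1.

(* The default value 1 is only reached when n = 0: the ratio is then 1. *)
Definition cond_number m n (X : 'M[R]_(m, n)) : \bar R :=
  let s := singular_values X in
  if last 1 s == 0 then +oo%E else (head 1 s / last 1 s)%:E.

Definition orthonormal_mx m n (U : 'M[R]_(m, n)) : Prop := U^T *m U = 1%:M.

Definition mxrange m n (X : 'M[R]_(m, n)) : {vspace 'cV[R]_m} :=
  limg (linfun (mulmx X : 'cV[R]_n -> 'cV[R]_m)).

(* U is some orthonormal matrix with range L; the value does not depend on
   which one, since two of them differ by an orthogonal factor on the right. *)
Definition restricted_cond d m (S : 'M[R]_(d, m)) (L : {vspace 'cV[R]_m}) :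
    \bar R :=
  let U : 'M[R]_(m, \dim L) :=
    xget 0 [set U : 'M[R]_(m, \dim L) | orthonormal_mx U /\ mxrange U = L]%classic
  in cond_number (S *m U).

End SingularValues.

Section Blocks.
Variable R : realType.

Definition mx_entry m n (A : 'M[R]_(m, n)) (i j : nat) : R :=
  match insub i : option 'I_m, insub j : option 'I_n with
  | Some i', Some j' => A i' j'
  | _, _ => 0
  end.

(* The p x q block of A whose top left entry has 0-based position (i0, j0).
   Entries that would fall outside A are 0; this never happens when the block
   fits inside A. *)
Definition mxslice m n (A : 'M[R]_(m, n)) (i0 p j0 q : nat) : 'M[R]_(p, q) :=
  \matrix_(i < p, j < q) mx_entry A (i0 + i) (j0 + j).

Definition blockA k n (A : 'M[R]_(k, n)) (l : nat) : 'M[R]_l :=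
  mxslice A 0 l 0 l.

Definition blockC k n (A : 'M[R]_(k, n)) (l : nat) : 'M[R]_(k - l, n - l) :=
  mxslice A l (k - l) l (n - l).

End Blocks.

Section QRCP.
Variable R : realType.

(* Output [Q, R, J] of a QRCP algorithm, with Q restricted to its first k
   columns and R to its first k rows.  The number k is part of the output. *)
Record qr_output (m n : nat) := QROutput {
  qr_rank : nat;
  qr_Q : 'M[R]_(m, qr_rank);
  qr_R : 'M[R]_(qr_rank, n);
  qr_J : 'S_n }.

(* is_trig_mx means lower trapezoidal; col_perm J X is X[:, J]. *)
Definition is_qrcp m n (X : 'M[R]_(m, n)) (o : qr_output m n) : Prop :=
  [/\ qr_rank o = \rank X,
      orthonormal_mx (qr_Q o),
      is_trig_mx (qr_R o)^T
    & col_perm (qr_J o) X = qr_Q o *m qr_R o].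

(* Only the values f 1, ..., f k matter. *)
Definition rrqr_property m n (alg : 'M[R]_(m, n) -> qr_output m n)
    (X : 'M[R]_(m, n)) (k : nat) (f : nat -> R) : Prop :=
  [/\ (n <= m)%N,
      \rank X = k,
      (forall l, (1 <= l <= k)%N -> 1 <= f l),
      is_qrcp X (alg X)
    & forall l, (1 <= l <= k)%N ->
        (forall j, (1 <= j <= l)%N ->
           sigma j X / f l <= sigma j (blockA (qr_R (alg X)) l)) /\
        (forall j, (1 <= j <= k - l)%N ->
           sigma j (blockC (qr_R (alg X)) l) <= f l * sigma (l + j) X)].

(* The positive diagonal makes the factor of a positive definite matrix
   unique.  The value is 0 if there is no such factor. *)
Definition chol k (G : 'M[R]_k) : 'M[R]_k :=
  xget 0 [set T : 'M[R]_k | [/\ is_trig_mx T^T,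
                                (forall i, 0 < T i i)
                              & G = T^T *m T]]%classic.

Definition cqrrpt_core d m n (qrcp : 'M[R]_(d, n) -> qr_output d n)
    (M : 'M[R]_(m, n)) (S : 'M[R]_(d, m)) : qr_output m n :=
  let Msk := S *m M in
  let osk := qrcp Msk in
  let Rsk := qr_R osk in
  let J := qr_J osk in
  let k := \rank Rsk in
  let Mpre := mxslice (col_perm J M) 0 m 0 k *m invmx (mxslice Rsk 0 k 0 k) in
  let G := Mpre^T *m Mpre in
  let Rpre := chol G in
  let Qk := Mpre *m invmx Rpre in
  let Rk := Rpre *m mxslice Rsk 0 k 0 n in
  @QROutput m n k Qk Rk J.

End QRCP.

(* Main.v *)
Require Import Defs.
From mathcomp Require Import all_boot all_order all_algebra all_fingroup.
From mathcomp Require Import boolp classical_sets reals constructive_ereal.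
From mathcomp Require Import complex polyrcf ring.

Set Implicit Arguments.
Unset Strict Implicit.
Unset Printing Implicit Defensive.

Import Order.TTheory GRing.Theory Num.Theory.
Local Open Scope ring_scope.

(** Write [lo] and [hi] for the smallest and largest factors by which [S]
    stretches the vectors of the range of [M].  Then [c = hi / lo] and
    [lo |Mv| <= |SMv| <= hi |Mv|] for all [v] ([restricted_cond_bounds]).

    The algorithm multiplies the sketched factor [A] of [qrcp] by the Cholesky
    factor [T] of the Gram matrix of [B], the preconditioned matrix.  By
    construction [S B] is the orthonormal factor of the sketch, so that
    [|v| = |S B v|]; as [|T v| = |B v|] and the columns of [B] are in the range
    of [M], [T] distorts every vector by a factor between [1 / hi] and
    [1 / lo].  Since [S] is injective on the range of [M], the identity
    [S M P = (S B) A] lifts to [M P = B A = (B T^-1) (T A)], which is the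
    decomposition returned by the algorithm ([cqrrpt_from_spec]).

    Everything else is a comparison of singular values, and all of it goes
    through one fact ([sigma_le]): if [|X v| <= a |Y v|] for every [v], then
    each singular value of [X] is at most [a] times that of [Y].  The sketch costs
    a factor [lo] on one side and [hi] on the other.  Because [T] is upper
    triangular and [A] upper trapezoidal, the diagonal blocks of [T A] are
    products of diagonal blocks, and the diagonal blocks of [T] satisfy the
    same one-sided bound as [T] ([sigma_blockA_mul], [sigma_blockC_mul]).  Hence
    - [lo sigma_j(M) <= sigma_j(SM) <= f sigma_j(A_l) <= f hi sigma_j((TA)_l)],
    - [lo sigma_j((TA)^l) <= sigma_j(A^l) <= f sigma_(l+j)(SM)
       <= f hi sigma_(l+j)(M)],
    where [_l] and [^l] denote the leading and trailing blocks; dividing by [lo]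
    puts [c f] in front.

    The comparison [sigma_le] rests on the spectral theorem for real symmetric
    matrices ([real_symmetric_spectral]): it turns [|X v|^2] into a weighted sum
    of squares of orthonormal coordinates, with the squared singular values as
    weights, from which the Courant-Fischer argument applies. *)

(** * Squared Euclidean norm *)

Section SquaredNorm.
Variable R : realType.

Definition sqnorm n (v : 'cV[R]_n) : R := \sum_i v i 0 ^+ 2.

Lemma sqnormE n (v : 'cV[R]_n) : v^T *m v = (sqnorm v)%:M.
Proof.
apply/matrixP=> i j; rewrite !ord1 !mxE eqxx mulr1n.
by apply: eq_bigr => l _; rewrite mxE expr2.
Qed.

Lemma sqnorm_ge0 n (v : 'cV[R]_n) : 0 <= sqnorm v.
Proof. by apply: sumr_ge0 => i _; apply: sqr_ge0. Qed.

Lemma sqnorm_eq0 n (v : 'cV[R]_n) : (sqnorm v == 0) = (v == 0).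
Proof.
apply/eqP/eqP => [/eqP|->]; last by apply: big1 => i _; rewrite mxE expr0n.
rewrite psumr_eq0 => [/allP v0|i _]; last exact: sqr_ge0.
apply/matrixP=> i j; rewrite ord1 [RHS]mxE; apply/eqP.
by rewrite -sqrf_eq0; apply: (implyP (v0 i (mem_index_enum i))).
Qed.

Lemma sqnorm0 n : sqnorm (0 : 'cV[R]_n) = 0.
Proof. by apply/eqP; rewrite sqnorm_eq0. Qed.

Lemma sqnorm_gt0 n (v : 'cV[R]_n) : (0 < sqnorm v) = (v != 0).
Proof. by rewrite lt0r sqnorm_ge0 andbT sqnorm_eq0. Qed.

Lemma sqnorm_gram m n p (X : 'M[R]_(m, n)) (Y : 'M[R]_(p, n)) :
  X^T *m X = Y^T *m Y -> forall v, sqnorm (X *m v) = sqnorm (Y *m v).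
Proof.
move=> XY v; have: (sqnorm (X *m v))%:M = (sqnorm (Y *m v))%:M :> 'M_1.
  by rewrite -!sqnormE !trmx_mul !mulmxA -!(mulmxA v^T) XY.
by move/matrixP/(_ 0 0); rewrite !mxE.
Qed.

Lemma sqnorm_orthonormal m n (U : 'M[R]_(m, n)) (v : 'cV[R]_n) :
  orthonormal_mx U -> sqnorm (U *m v) = sqnorm v.
Proof.
move=> U1; rewrite (@sqnorm_gram _ _ _ U 1%:M) ?mul1mx //.
by rewrite U1 trmx1 mulmx1.
Qed.

Lemma sqnormZ n a (v : 'cV[R]_n) : sqnorm (a *: v) = a ^+ 2 * sqnorm v.
Proof. by rewrite mulr_sumr; apply: eq_bigr => i _; rewrite mxE exprMn. Qed.

Lemma sqnorm_col_mx m n (u : 'cV[R]_m) (v : 'cV[R]_n) :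
  sqnorm (col_mx u v) = sqnorm u + sqnorm v.
Proof.
rewrite /sqnorm big_split_ord.
by congr (_ + _); apply: eq_bigr => i _; rewrite ?col_mxEu ?col_mxEd.
Qed.

End SquaredNorm.

(** * Spectral theorem for real symmetric matrices *)

Section Spectral.
Variable R : realType.

Lemma orthonormal_mxC n (P : 'M[R]_n) : orthonormal_mx P -> P *m P^T = 1%:M.
Proof. exact: mulmx1C. Qed.

Lemma orthonormal_mxM m n p (P : 'M[R]_(m, n)) (Q : 'M[R]_(n, p)) :
  orthonormal_mx P -> orthonormal_mx Q -> orthonormal_mx (P *m Q).
Proof.
rewrite /orthonormal_mx => P1 Q1.
by rewrite trmx_mul mulmxA -(mulmxA Q^T) P1 mulmx1.
Qed.

(** Over the complex numbers a real symmetric matrix is Hermitian, so that its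
    eigenvalues are real; the real characteristic polynomial then has a root. *)
Lemma symmetric_eigenvector n (A : 'M[R]_n.+1) : A^T = A ->
  exists a (v : 'cV[R]_n.+1), sqnorm v = 1 /\ A *m v = a *: v.
Proof.
move=> AT; pose AC := map_mx (real_complex R) A.
have ACsym : AC \is hermsymmx.
  apply: realsym_hermsym.
    by apply/is_hermitianmxP; rewrite expr0 scale1r map_mx_id // map_trmx AT.
  by apply/mxOverP=> i j; rewrite mxE; apply/complex_realP; exists (A i j).
have sp_real := hermitian_spectral_diag_real ACsym.
have /orthomx_spectralP := hermitian_normalmx ACsym.
set P := spectralmx AC; set sp := spectral_diag AC => AE.
have Pu : P \in unitmx := spectral_unit _.
have /complex_realP[a aE] : sp 0 0 \is Num.real by apply: (mxOverP sp_real).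
have : eigenvalue AC (sp 0 0).
  apply/eigenvalueP; exists (row 0 P).
    rewrite {1}AE !mulmxA -row_mul mulmxV // row1 -rowE.
    by rewrite row_diag_mx -scalemxAl -rowE.
  apply/eqP => /(congr1 (fun u => u *m invmx P)).
  rewrite -row_mul mulmxV // mul0mx row1 => /matrixP/(_ 0 0).
  by rewrite !mxE !eqxx => /eqP; rewrite oner_eq0.
rewrite aE eigenvalue_root_char /AC -map_char_poly fmorph_root.
rewrite -eigenvalue_root_char => /eigenvalueP[u uA u0].
have nu : 0 < sqnorm u^T by rewrite sqnorm_gt0 trmx_eq0.
exists a, ((Num.sqrt (sqnorm u^T))^-1 *: u^T); split.
  by rewrite sqnormZ exprVn sqr_sqrtr ?ltW // mulVf ?gt_eqF.
by rewrite -scalemxAr -{1}AT -trmx_mul uA linearZ /= scalerA mulrC -scalerA.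
Qed.

(** The witness is the reflection along [v - e], with [e] the first basis vector.
    It completes the unit vector [v] to an orthonormal basis. *)
Lemma householder n (v : 'cV[R]_n.+1) : sqnorm v = 1 ->
  exists H : 'M[R]_n.+1, [/\ H^T = H, orthonormal_mx H & H *m delta_mx 0 0 = v].
Proof.
move=> v1; set e : 'cV[R]_n.+1 := delta_mx 0 0.
have [->|ve] := eqVneq v e.
  by exists 1%:M; split; rewrite /orthonormal_mx ?trmx1 ?mul1mx.
pose w := v - e; pose s := sqnorm w.
have s0 : s != 0 by rewrite /s sqnorm_eq0 subr_eq0.
have sE : s = 2 * (1 - v 0 0).
  have ee : sqnorm e = 1.
    rewrite /sqnorm (bigD1 0) //= big1 => [|i /negbTE i0]; rewrite !mxE.
      by rewrite eqxx expr1n addr0.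
    by rewrite i0 expr0n.
  have -> : s = sqnorm v + sqnorm e - 2 * v 0 0.
    rewrite /s /sqnorm -!big_split /=.
    have -> : 2 * v 0 0 = \sum_i 2 * (v i 0 * e i 0).
      rewrite (bigD1 0) //= big1 => [|i /negbTE i0]; rewrite !mxE.
        by rewrite eqxx mulr1 addr0.
      by rewrite i0 /= !mulr0.
    by rewrite -sumrB; apply: eq_bigr => i _; rewrite !mxE /=; ring.
  by rewrite v1 ee; ring.
pose H : 'M[R]_n.+1 := 1%:M - (2 / s) *: (w *m w^T).
have HT : H^T = H.
  by rewrite /H linearB linearZ /= trmx1 trmx_mul trmxK.
exists H; split=> //.
  have WW : w *m w^T *m (w *m w^T) = s *: (w *m w^T).
    by rewrite mulmxA -(mulmxA w) sqnormE mul_mx_scalar -scalemxAl.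
  rewrite /orthonormal_mx HT /H mulmxBl mul1mx mulmxBr mulmx1.
  rewrite -!scalemxAl -!scalemxAr WW !scalerA -scalerBl -addrA -opprD -scalerDl.
  rewrite [X in X *: _](_ : _ = 0); last by field.
  by rewrite scale0r subr0.
rewrite /H mulmxBl mul1mx -scalemxAl -mulmxA.
have -> : w^T *m e = (v 0 0 - 1)%:M.
  by apply/matrixP=> i j; rewrite !ord1 -colE !mxE eqxx /= mulr1n.
rewrite mul_mx_scalar scalerA sE.
have -> : 2 / (2 * (1 - v 0 0)) * (v 0 0 - 1) = -1.
  by field; move: s0; rewrite sE mulf_eq0 pnatr_eq0.
by rewrite scaleN1r opprK /w addrC subrK.
Qed.

(** By deflation: conjugating [A] by the reflection that sends the first basis
    vector to a unit eigenvector makes [A] block diagonal, by symmetry, with a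
    block of size 1. *)
Lemma real_symmetric_spectral n (A : 'M[R]_n) : A^T = A ->
  exists (P : 'M[R]_n) (s : 'rV[R]_n),
    orthonormal_mx P /\ A = P *m diag_mx s *m P^T.
Proof.
elim: n A => [|n IHn] A AT.
  by exists 1%:M, 0; split; apply/matrixP => -[].
have [a [v [v1 Av]]] := symmetric_eigenvector AT.
have [H [HT H1 He]] := householder v1.
have HH : H *m H = 1%:M by move: H1; rewrite /orthonormal_mx HT.
(* B is abstract, so that mxE stops at its entries. *)
have [B BE] : exists B : 'M[R]_(1 + n), B = H *m A *m H by eexists.
have BT : B^T = B by rewrite BE !trmx_mul HT AT mulmxA.
have Be : B *m delta_mx 0 0 = a *: (delta_mx 0 0 : 'cV_(1 + n)).
  rewrite BE -!mulmxA He Av -scalemxAr -[v in H *m v]He mulmxA.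
  by rewrite HH mul1mx.
have Bl : dlsubmx B = 0.
  apply/matrixP=> i j; rewrite !mxE ord1.
  have /matrixP/(_ (rshift 1 i) 0) := Be.
  rewrite -colE !mxE /= mulr0 => B0; rewrite -[RHS]B0.
  by congr (B _ _); apply: val_inj.
have Br : ursubmx B = 0 by rewrite -[ursubmx B]trmxK trmx_ursub BT Bl trmx0.
have BrT : (drsubmx B)^T = drsubmx B by rewrite trmx_drsub BT.
have [P [s [P1 sE]]] := IHn _ BrT.
pose K : 'M[R]_(1 + n) := block_mx 1%:M 0 0 P.
have KT : K^T = block_mx 1%:M 0 0 P^T by rewrite tr_block_mx !trmx0 trmx1.
have K1 : orthonormal_mx K.
  rewrite /orthonormal_mx KT mulmx_block !mulmx0 !mul0mx !addr0 add0r mul1mx P1.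
  exact/esym/scalar_mx_block.
pose D : 'rV[R]_(1 + n) := row_mx (ulsubmx B) s.
have BD : B = K *m diag_mx D *m K^T.
  have -> : diag_mx D = block_mx (ulsubmx B) 0 0 (diag_mx s).
    rewrite diag_mx_row; congr block_mx; apply/matrixP=> i j.
    by rewrite !ord1 !mxE eqxx mulr1n.
  rewrite KT /K !mulmx_block !mulmx0 !mul0mx !addr0 !add0r !mul0mx.
  by rewrite mulmx1 mul1mx -sE -{1}[B]submxK Bl Br.
exists (H *m K), D; split; first exact: orthonormal_mxM.
have -> : A = H *m B *m H.
  by rewrite BE !mulmxA HH mul1mx -mulmxA HH mulmx1.
by rewrite BD trmx_mul HT !mulmxA.
Qed.

End Spectral.

(** * Singular values *)

Section SingularValuesTheory.
Variable R : realType.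

Lemma char_poly_orthonormal n (P B : 'M[R]_n) : orthonormal_mx P ->
  char_poly (P *m B *m P^T) = char_poly B.
Proof.
move=> P1; pose PX := map_mx polyC P; pose PXT := map_mx polyC P^T.
have PP : PX *m PXT = 1%:M.
  by rewrite -map_mxM (orthonormal_mxC P1) map_mx1.
have E : char_poly_mx (P *m B *m P^T) = PX *m char_poly_mx B *m PXT.
  rewrite /char_poly_mx !map_mxM mulmxBr mulmxBl; congr (_ - _).
  by rewrite mul_mx_scalar -scalemxAl PP scalemx1.
rewrite /char_poly E !det_mulmx mulrAC -det_mulmx PP det1.
exact: mul1r.
Qed.

(** The characteristic polynomial is the product of the ['X - s_i], in which the
    multiplicity of a root is its number of occurrences among the [s_i]. *)
Lemma eigenvalues_spectral n (A P : 'M[R]_n) (s : 'rV[R]_n) :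
  orthonormal_mx P -> A = P *m diag_mx s *m P^T ->
  perm_eq (eigenvalues A) [seq s 0 i | i : 'I_n].
Proof.
move=> P1 AE; set t := [seq _ | _ : _].
have pE : char_poly A = \prod_(a <- t) ('X - a%:P).
  rewrite AE char_poly_orthonormal // char_poly_trig ?diag_mx_is_trig //.
  by rewrite big_map big_enum; apply: eq_bigr => i _; rewrite mxE eqxx.
have p0 : char_poly A != 0 by rewrite monic_neq0 ?char_poly_monic.
apply/allP => x _ /=; rewrite /eigenvalues count_flatten -map_comp.
pose p := char_poly A; pose r := rootsR p.
rewrite (eq_map (_ : _ =1 fun a => (a == x) * mup a p)%N); last first.
  by move=> a /=; rewrite count_nseq.
have -> : sumn [seq ((a == x) * mup a p)%N | a <- r] = ((x \in r) * mup x p)%N.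
  elim: r (uniq_roots _ _ _ : uniq r) => //= a r IH.
  case/andP=> ar /IH ->; rewrite inE eq_sym.
  by have [->|] := eqVneq x a; rewrite ?(negPf ar) //= mul1n addn0.
rewrite /r -(roots_on_rootsR p0) ?inE //=.
have [_|/mupNroot] := boolP (root _ _); last rewrite mul0n.
  by rewrite mul1n /p pE mu_prod_XsubC.
by rewrite /p pE mu_prod_XsubC => ->.
Qed.

Lemma sorted_singular_values m n (X : 'M[R]_(m, n)) :
  sorted >=%R (singular_values X).
Proof. by apply: sort_sorted => x y; apply: le_total. Qed.

(** The right singular vectors can be ordered so that the [i]-th one goes with
    the [i]-th largest singular value: the spectral theorem gives them in some
    order, and the columns of its orthonormal matrix are permuted. *)
Lemma singular_values_spectral m n (X : 'M[R]_(m, n)) :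
  exists P : 'M[R]_n, [/\ orthonormal_mx P,
    size (singular_values X) = n,
    {in singular_values X, forall x, 0 <= x}
    & forall v, sqnorm (X *m v) =
        \sum_(i < n) sigma i.+1 X ^+ 2 * (P^T *m v) i 0 ^+ 2].
Proof.
have [Q [s [Q1 XE]]] : exists (P : 'M[R]_n) (s : 'rV[R]_n),
    orthonormal_mx P /\ X^T *m X = P *m diag_mx s *m P^T.
  by apply: real_symmetric_spectral; rewrite trmx_mul trmxK.
have nX v : sqnorm (X *m v) = \sum_i s 0 i * (Q^T *m v) i 0 ^+ 2.
  have : (sqnorm (X *m v))%:M = (Q^T *m v)^T *m (diag_mx s *m (Q^T *m v)).
    by rewrite -sqnormE !trmx_mul trmxK !mulmxA -(mulmxA v^T) XE !mulmxA.
  move: (Q^T *m v) => w /matrixP/(_ 0 0); rewrite mxE eqxx mulr1n => ->.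
  by rewrite mul_diag_mx mxE; apply: eq_bigr => i _; rewrite !mxE; ring.
have s_ge0 i : 0 <= s 0 i.
  have := sqnorm_ge0 (X *m (Q *m delta_mx i 0)).
  rewrite nX mulmxA Q1 mul1mx (bigD1 i) //= big1 => [|j /negbTE ji].
    by rewrite mxE !eqxx expr1n mulr1 addr0.
  by rewrite mxE ji expr0n mulr0.
pose t : n.-tuple R := [tuple Num.sqrt (s 0 i) | i < n].
have st : perm_eq (singular_values X) t.
  rewrite perm_sort; have := eigenvalues_spectral Q1 XE.
  by move/(perm_map Num.sqrt); rewrite -map_comp.
have sz : size (singular_values X) = n by rewrite (perm_size st) size_tuple.
have /tuple_permP[p pE] := st.
have sgE (i : 'I_n) : sigma i.+1 X = Num.sqrt (s 0 (p i)).
  rewrite /sigma pE /= -[LHS](tnth_nth 0 [tuple tnth t (p i) | i < n] i).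
  by rewrite !tnth_mktuple.
exists (col_perm p Q); split=> //.
- rewrite /orthonormal_mx col_permE trmx_mul tr_perm_mx mulmxA -(mulmxA _ Q^T).
  by rewrite Q1 mulmx1 -perm_mxM mulVg perm_mx1.
- by move=> x; rewrite (perm_mem st) => /mapP[i _ ->]; apply: sqrtr_ge0.
move=> v; rewrite nX (reindex_inj (@perm_inj _ p)) /=; apply: eq_bigr => i _.
rewrite sgE sqr_sqrtr //; congr (_ * _ ^+ 2).
by rewrite !mxE; apply: eq_bigr => j _; rewrite !mxE.
Qed.

Lemma sigma_ge0 m n j (X : 'M[R]_(m, n)) : 0 <= sigma j X.
Proof.
have [_ [_ _ pos _]] := singular_values_spectral X; rewrite /sigma.
have [le|lt] := leqP (size (singular_values X)) j.-1.
  by rewrite nth_default.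
exact/pos/mem_nth.
Qed.

Lemma sigma_out m n j (X : 'M[R]_(m, n)) : (n < j)%N -> sigma j X = 0.
Proof.
have [_ [_ sz _ _]] := singular_values_spectral X.
by case: j => // j nj; rewrite /sigma nth_default ?sz.
Qed.

Lemma sigma_le_index m n i j (X : 'M[R]_(m, n)) :
  (i <= j)%N -> sigma j X <= sigma i X.
Proof.
move=> ij; have [nj|jn] := ltnP n j; first by rewrite sigma_out ?sigma_ge0.
case: n jn X => [|n] jn X.
  by move: jn ij; rewrite leqn0 => /eqP->; rewrite leqn0 => /eqP->.
have [_ [_ sz _ _]] := singular_values_spectral X.
apply: (sorted_leq_nth _ _ _ (sorted_singular_values X)).
- by move=> x y z /= xy zx; apply: le_trans zx xy.
- by move=> x /=.
- by rewrite inE sz; case: i ij => //= i ij; apply: leq_trans ij jn.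
- by rewrite inE sz; case: j jn {ij}.
- by case: i j ij {jn} => [|i] [|j].
Qed.

(** One half of Courant-Fischer.  The vectors orthogonal to the first [j - 1]
    right singular vectors are stretched by at most [sigma j X].  The subspace
    is the kernel of a square matrix, which makes its codimension a rank. *)
Lemma sigma_upper m n j (X : 'M[R]_(m, n)) :
  exists2 V : 'M[R]_n, (\rank V <= j.-1)%N &
    forall v, V *m v = 0 -> sqnorm (X *m v) <= sigma j X ^+ 2 * sqnorm v.
Proof.
have [P [P1 _ _ nX]] := singular_values_spectral X.
exists (pid_mx j.-1 *m P^T).
  apply: leq_trans (mxrankM_maxl _ _) _.
  by rewrite -pid_mx_minv rank_pid_mx ?geq_minl ?geq_minr.
have PT1 : orthonormal_mx P^T by rewrite /orthonormal_mx trmxK orthonormal_mxC.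
move=> v Vv; rewrite nX -(sqnorm_orthonormal v PT1).
rewrite mulr_sumr; apply: ler_sum => i _.
have [ij|ji] := ltnP i j.-1.
  have /matrixP/(_ i 0) := Vv; rewrite -mulmxA mxE (bigD1 i) //= big1.
    rewrite [pid_mx _ _ _]mxE eqxx ij mul1r addr0 => ->.
    by rewrite mxE expr0n !mulr0.
  by move=> l li; rewrite mxE eq_sym (negbTE (li : val l != val i)) mul0r.
apply: ler_wpM2r; first exact: sqr_ge0.
by rewrite ler_sqr ?nnegrE ?sigma_ge0 // sigma_le_index //; case: j ji {Vv}.
Qed.

(** The other half: on the span of the first [j] right singular vectors, given
    as the kernel of a matrix of rank [n - j], lengths are multiplied by at
    least [sigma j X]. *)
Lemma sigma_lower m n j (X : 'M[R]_(m, n)) : (j <= n)%N ->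
  exists2 W : 'M[R]_n, (\rank W <= n - j)%N &
    forall v, W *m v = 0 -> sigma j X ^+ 2 * sqnorm v <= sqnorm (X *m v).
Proof.
move=> jn; have [P [P1 _ _ nX]] := singular_values_spectral X.
exists (copid_mx j *m P^T).
  by apply: leq_trans (mxrankM_maxl _ _) _; rewrite rank_copid_mx.
have PT1 : orthonormal_mx P^T by rewrite /orthonormal_mx trmxK orthonormal_mxC.
move=> v Vv; rewrite nX -(sqnorm_orthonormal v PT1).
rewrite mulr_sumr; apply: ler_sum => i _.
have [ij|ji] := leqP j i.
  have /matrixP/(_ i 0) := Vv; rewrite -mulmxA mxE (bigD1 i) //= big1.
    rewrite !mxE !eqxx ltnNge ij /= subr0 mul1r addr0 => ->.
    by rewrite expr0n !mulr0.
  move=> l li; rewrite !mxE eq_sym (negbTE li) eq_sym.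
  rewrite (negbTE (li : val l != val i)).
  by rewrite subr0 mul0r.
apply: ler_wpM2r; first exact: sqr_ge0.
by rewrite ler_sqr ?nnegrE ?sigma_ge0 // sigma_le_index.
Qed.

Lemma exists_ker_vec m n (A : 'M[R]_(m, n)) : (\rank A < n)%N ->
  exists2 v : 'cV[R]_n, v != 0 & A *m v = 0.
Proof.
move=> rA; have : kermx A^T != 0.
  by rewrite -mxrank_eq0 mxrank_ker mxrank_tr -lt0n subn_gt0.
case/rowV0Pn => u /sub_kermxP uA u0; exists u^T; rewrite ?trmx_eq0 //.
by rewrite -[A]trmxK -trmx_mul uA trmx0.
Qed.

(** The subspaces of [sigma_lower] for [X] and [sigma_upper] for [Y] have
    codimensions [n - j] and [j - 1], hence a common nonzero vector [v], and
    [sigma j X |v| <= |X v| <= a |Y v| <= a sigma j Y |v|]. *)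
Lemma sigma_le m p n j (X : 'M[R]_(m, n)) (Y : 'M[R]_(p, n)) (a : R) :
  (0 < j)%N -> 0 <= a ->
  (forall v, sqnorm (X *m v) <= a ^+ 2 * sqnorm (Y *m v)) ->
  sigma j X <= a * sigma j Y.
Proof.
move=> j0 a0 XY; have [nj|jn] := ltnP n j; first by rewrite !sigma_out ?mulr0.
have [W rW Wle] := sigma_lower X jn; have [V rV Vle] := sigma_upper j Y.
have [|v v0 /eqP] := @exists_ker_vec _ _ (col_mx V W).
  rewrite -addsmxE (leq_ltn_trans (mxrank_adds_leqif _ _)) //.
  apply: leq_ltn_trans (leq_add rV rW) _.
  by rewrite addnBA // ltn_subLR ?ltn_add2r ?prednK // (leq_trans jn) ?leq_addl.
rewrite mul_col_mx col_mx_eq0 => /andP[/eqP/Vle Yv /eqP/Wle Xv].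
rewrite -ler_sqr ?nnegrE ?mulr_ge0 ?sigma_ge0 //.
have nv : 0 < sqnorm v by rewrite sqnorm_gt0.
rewrite -(ler_pM2r nv); apply: le_trans Xv _; apply: le_trans (XY v) _.
by rewrite exprMn -[leRHS]mulrA ler_wpM2l ?sqr_ge0.
Qed.

Lemma sigma1_ub m n (X : 'M[R]_(m, n)) v :
  sqnorm (X *m v) <= sigma 1 X ^+ 2 * sqnorm v.
Proof.
have [V /=] := sigma_upper 1 X; rewrite leqn0 mxrank_eq0 => /eqP-> le.
by apply: le; rewrite mul0mx.
Qed.

Lemma sigman_lb m n (X : 'M[R]_(m, n)) v :
  sigma n X ^+ 2 * sqnorm v <= sqnorm (X *m v).
Proof.
have [W] := sigma_lower X (leqnn n).
rewrite subnn leqn0 mxrank_eq0 => /eqP-> le.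
by apply: le; rewrite mul0mx.
Qed.

(** If [sigma j X = 0] then [X] vanishes on the kernel of a matrix of rank less
    than [j], so its own rank is less than [j]. *)
Lemma sigma_rank_gt0 m n (X : 'M[R]_(m, n)) j :
  (0 < j <= \rank X)%N -> 0 < sigma j X.
Proof.
case/andP=> j0 jr; rewrite lt0r sigma_ge0 andbT; apply: contraTneq jr => s0.
have [V rV Vle] := sigma_upper j X; rewrite -ltnNge.
suff XV : (X <= V)%MS.
  by rewrite (leq_ltn_trans (mxrankS XV)) // (leq_ltn_trans rV) // prednK.
rewrite submxE; apply/eqP/matrixP=> i l.
pose v : 'cV[R]_n := cokermx V *m delta_mx l 0.
have /Vle : V *m v = 0 by rewrite mulmxA mulmx_coker mul0mx.
rewrite s0 expr0n mul0r => le0.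
have /eqP : sqnorm (X *m v) = 0 by apply: le_anti; rewrite le0 sqnorm_ge0.
by rewrite sqnorm_eq0 mulmxA -colE => /eqP/matrixP/(_ i 0); rewrite !mxE.
Qed.

End SingularValuesTheory.

(** * Cholesky factorization *)

Section Cholesky.
Variable R : realType.

Definition qform n (G : 'M[R]_n) (v : 'cV[R]_n) : R := (v^T *m G *m v) 0 0.

(** Induction on the size, with the Schur complement
    [C - b^T b / a], whose value at [v] is that of [G] at [(- b v / a, v)]. *)
Lemma cholesky_exists n (G : 'M[R]_n) : G^T = G ->
  (forall v : 'cV[R]_n, v != 0 -> 0 < qform G v) ->
  exists T : 'M[R]_n, [/\ is_trig_mx T^T, forall i, 0 < T i i & G = T^T *m T].
Proof.
elim: n G => [|n IHn] G GT Gpos.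
  by exists 0; split; [apply/is_trig_mxP=> -[] | case | apply/matrixP=> -[]].
move: (G : 'M_(1 + n)) GT Gpos => {}G GT Gpos0.
have Gpos (v : 'cV[R]_(1 + n)) : v != 0 -> 0 < qform G v := Gpos0 v.
pose a := G 0 0; pose b := ursubmx G; pose C := drsubmx G.
have ulE : ulsubmx G = a%:M.
  apply/matrixP=> i j; rewrite !ord1 !mxE eqxx mulr1n.
  by congr (G _ _); apply: val_inj.
have GE : G = block_mx a%:M b b^T C.
  by rewrite -[G]submxK ulE /b trmx_ursub GT.
have a0 : 0 < a.
  have := Gpos (col_mx 1%:M 0 : 'cV[R]_(1 + n)).
  rewrite col_mx_eq0 negb_and oner_eq0 => /(_ isT).
  rewrite /qform GE tr_col_mx trmx1 trmx0 mul_row_block mul_row_col.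
  by rewrite !mul0mx mulmx0 !addr0 mul1mx mulmx1 mxE eqxx.
have [T [Ttrig Tpos TE]] : exists T : 'M[R]_n, [/\ is_trig_mx T^T,
    forall i, 0 < T i i & C - a^-1 *: (b^T *m b) = T^T *m T].
  apply: IHn => [|v v0].
    by rewrite linearB linearZ /= trmx_mul trmxK /C trmx_drsub GT.
  have := Gpos (col_mx (- a^-1 *: (b *m v)) v : 'cV[R]_(1 + n)).
  rewrite col_mx_eq0 negb_and v0 orbT => /(_ isT).
  congr (_ < _); rewrite /qform; congr (fun_of_matrix _ 0 0).
  rewrite GE tr_col_mx mul_row_block mul_row_col.
  rewrite !linearZ /= trmx_mul mul_mx_scalar -!scalemxAl !mulmxDl scalerA.
  rewrite mulrN mulfV ?gt_eqF // scaleN1r mulNmx addNr scaler0 add0r.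
  rewrite scalerN mulmxBr mulmxBl -!scalemxAr -!scalemxAl !mulmxA.
  by rewrite scaleNr addrC.
pose r := Num.sqrt a; have r0 : 0 < r by rewrite sqrtr_gt0.
have rr : r * r = a by rewrite -expr2 sqr_sqrtr ?ltW.
pose K : 'M[R]_(1 + n) := block_mx r%:M (r^-1 *: b) 0 T.
have KT : K^T = block_mx r%:M 0 (r^-1 *: b^T) T^T.
  by rewrite tr_block_mx trmx0 tr_scalar_mx linearZ.
have Ktrig : is_trig_mx K^T.
  by rewrite KT is_trig_block_mx // eqxx Ttrig scalar_mx_is_trig.
have Kpos i : 0 < K i i.
  have [j|j] := split_ordP i => ->; rewrite ?block_mxEul ?block_mxEdr //.
  by rewrite ord1 mxE eqxx.
exists K; split=> //.
rewrite -[LHS]/(G : 'M_(1 + n)) GE -[RHS]/(K^T *m K : 'M_(1 + n)) KT.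
rewrite mulmx_block !mul0mx !mulmx0 !addr0 -scalar_mxM rr.
rewrite mul_scalar_mx mul_mx_scalar !scalerA mulfV ?gt_eqF // !scale1r -TE.
by rewrite -scalemxAl -scalemxAr scalerA -invfM rr addrC subrK.
Qed.

Lemma cholP n (G : 'M[R]_n) : G^T = G ->
  (forall v : 'cV[R]_n, v != 0 -> 0 < qform G v) ->
  [/\ is_trig_mx (chol G)^T, forall i, 0 < chol G i i
    & G = (chol G)^T *m chol G].
Proof. by move=> GT Gpos; apply: xgetPex (cholesky_exists GT Gpos). Qed.

(** Cholesky QR: the Cholesky factor [T] of the Gram matrix of an injective [B]
    is the triangular factor of a QR decomposition of [B]. *)
Lemma chol_gram m k (B : 'M[R]_(m, k)) (T := chol (B^T *m B)) :
  (forall v : 'cV[R]_k, B *m v = 0 -> v = 0) ->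
  [/\ is_trig_mx T^T, T \in unitmx, orthonormal_mx (B *m invmx T)
    & forall v, sqnorm (T *m v) = sqnorm (B *m v)].
Proof.
move=> Binj; have [||Ttrig Tpos TE] := @cholP _ (B^T *m B).
- by rewrite trmx_mul trmxK.
- move=> v v0; rewrite /qform !mulmxA -mulmxA -trmx_mul sqnormE mxE eqxx mulr1n.
  by rewrite sqnorm_gt0; apply: contra_neq v0 => /Binj.
have Tu : T \in unitmx.
  rewrite -unitmx_tr unitmxE det_trig // unitfE; apply/prodf_neq0 => i _.
  by rewrite mxE gt_eqF.
split=> //; last by move=> v; rewrite (sqnorm_gram TE).
rewrite /orthonormal_mx trmx_mul !mulmxA -(mulmxA _ B^T) TE trmx_inv.
by rewrite !mulmxA mulVmx ?unitmx_tr // mul1mx mulmxV.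
Qed.

End Cholesky.

(** * Restricted condition number *)

Section RestrictedCondition.
Variable R : realType.

Lemma mem_mxrange m n (X : 'M[R]_(m, n)) (y : 'cV[R]_m) :
  reflect (exists v, y = X *m v) (y \in mxrange X).
Proof.
apply: (iffP memv_imgP) => [[v _ ->]|[v ->]]; exists v => //.
- by rewrite lfunE.
- by rewrite memvf.
- by rewrite lfunE.
Qed.

(** Cholesky QR applied to the matrix of a basis of [L].  Hence the matrix
    chosen in [restricted_cond] does have its two properties. *)
Lemma exists_orthonormal_basis m (L : {vspace 'cV[R]_m}) :
  exists U : 'M[R]_(m, \dim L), orthonormal_mx U /\ mxrange U = L.
Proof.
pose B : 'M[R]_(m, \dim L) := \matrix_(i, j) (vbasis L)`_j i 0.
have BE (v : 'cV[R]_(\dim L)) : B *m v = \sum_j v j 0 *: (vbasis L)`_j.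
  apply/matrixP=> i j; rewrite ord1 mxE summxE; apply: eq_bigr => l _.
  by rewrite !mxE mulrC.
have Binj (v : 'cV[R]_(\dim L)) : B *m v = 0 -> v = 0.
  rewrite BE => v0; have /freeP/(_ _ v0){}v0 := basis_free (vbasisP L).
  by apply/matrixP=> i j; rewrite ord1 mxE v0.
have [_ Tu orth _] := chol_gram Binj.
exists (B *m invmx (chol (B^T *m B))); split=> //.
apply/vspaceP => y; apply/mem_mxrange/idP => [[v ->]|yL].
  rewrite -mulmxA BE memv_suml // => i _; apply/memvZ/vbasis_mem/mem_nth.
  by rewrite size_tuple.
exists (chol (B^T *m B) *m \col_i coord (vbasis L) i y).
rewrite -mulmxA mulKmx // BE {1}(coord_vbasis yL).
by apply: eq_bigr => i _; rewrite mxE.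
Qed.

(** For [n = 0] there are no singular values; [lo = hi = 1] is then a correct
    choice, consistent with the condition number 1. *)
Lemma cond_number_bounds m n (X : 'M[R]_(m, n)) (c : R) :
  cond_number X = c%:E -> exists lo hi : R, [/\ 0 < lo, lo <= hi, c = hi / lo
    & forall v, lo ^+ 2 * sqnorm v <= sqnorm (X *m v) <= hi ^+ 2 * sqnorm v].
Proof.
have [_ [_ sz _ _]] := singular_values_spectral X.
rewrite /cond_number; case: n X sz => [|n] X sz.
  rewrite (size0nil sz) /= oner_eq0 => -[<-]; exists 1, 1; split=> // v.
  by rewrite (flatmx0 v) mulmx0 !sqnorm0 !mulr0 lexx.
have -> : head 1 (singular_values X) = sigma 1 X.
  by rewrite /sigma; case: (singular_values X) sz.
have -> : last 1 (singular_values X) = sigma n.+1 X.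
  by rewrite (last_nth 0) sz /sigma; case: (singular_values X) sz.
case: ifPn => // s0 [<-]; exists (sigma n.+1 X), (sigma 1 X); split=> //.
- by rewrite lt0r s0 sigma_ge0.
- exact: sigma_le_index.
- by move=> v; rewrite sigman_lb sigma1_ub.
Qed.

Lemma restricted_cond_bounds d m n (S : 'M[R]_(d, m)) (M : 'M[R]_(m, n))
    (c : R) :
  restricted_cond S (mxrange M) = c%:E ->
  exists lo hi : R, [/\ 0 < lo, lo <= hi, c = hi / lo
    & forall v, lo ^+ 2 * sqnorm (M *m v) <= sqnorm (S *m (M *m v))
                <= hi ^+ 2 * sqnorm (M *m v)].
Proof.
rewrite /restricted_cond /=; set U := xget _ _.
have [U1 UM] : orthonormal_mx U /\ mxrange U = mxrange M.
  exact: (xgetPex _ (exists_orthonormal_basis (mxrange M))).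
case/cond_number_bounds => lo [hi [lo0 lohi cE bnd]].
exists lo, hi; split=> // v.
have /mem_mxrange[w ->] : M *m v \in mxrange U.
  by rewrite UM; apply/mem_mxrange; exists v.
by rewrite mulmxA sqnorm_orthonormal.
Qed.

End RestrictedCondition.

(** * Blocks of a product of upper trapezoidal matrices *)

Section Slices.
Variable R : realType.

Lemma mx_entry_ord m n (A : 'M[R]_(m, n)) (i : 'I_m) (j : 'I_n) :
  mx_entry A i j = A i j.
Proof. by rewrite /mx_entry !valK. Qed.

Lemma mxslice_full m n (A : 'M[R]_(m, n)) : mxslice A 0 m 0 n = A.
Proof. by apply/matrixP=> i j; rewrite mxE mx_entry_ord. Qed.

Lemma mxslice_pid m n k (A : 'M[R]_(m, n)) : (k <= n)%N ->
  mxslice A 0 m 0 k = A *m pid_mx k.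
Proof.
move=> kn; apply/matrixP=> i j; rewrite !mxE.
rewrite (mx_entry_ord A i (widen_ord kn j)) (bigD1 (widen_ord kn j)) //= big1.
  by rewrite !mxE /= eqxx ltn_ord mulr1 addr0.
move=> l; rewrite !mxE -(inj_eq val_inj) /= => /negbTE->.
by rewrite mulr0.
Qed.

Lemma mxslice_ul l p q (A : 'M[R]_(l + p, l + q)) :
  mxslice A 0 l 0 l = ulsubmx A.
Proof.
by apply/matrixP=> i j; rewrite !mxE (mx_entry_ord A (lshift p i) (lshift q j)).
Qed.

Lemma mxslice_dr l p q (A : 'M[R]_(l + p, l + q)) :
  mxslice A l p l q = drsubmx A.
Proof.
by apply/matrixP=> i j; rewrite !mxE (mx_entry_ord A (rshift l i) (rshift l j)).
Qed.

Lemma upper_trapezoidal_dl l p q (A : 'M[R]_(l + p, l + q)) :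
  is_trig_mx A^T -> dlsubmx A = 0.
Proof.
rewrite -[A]submxK tr_block_mx is_trig_block_mx // => /andP[/eqP/(congr1 trmx)].
by rewrite trmx0 trmxK block_mxKdl.
Qed.

Lemma blockA_mul l p q (T : 'M[R]_(l + p)) (A : 'M[R]_(l + p, l + q)) :
  is_trig_mx A^T ->
  mxslice (T *m A) 0 l 0 l = ulsubmx T *m mxslice A 0 l 0 l.
Proof.
move=> /upper_trapezoidal_dl Adl; rewrite !mxslice_ul.
by rewrite -{1}[T]submxK -{1}[A]submxK mulmx_block block_mxKul Adl mulmx0 addr0.
Qed.

Lemma blockC_mul l p q (T : 'M[R]_(l + p)) (A : 'M[R]_(l + p, l + q)) :
  is_trig_mx T^T ->
  mxslice (T *m A) l p l q = drsubmx T *m mxslice A l p l q.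
Proof.
move=> /upper_trapezoidal_dl Tdl; rewrite !mxslice_dr.
by rewrite -{1}[T]submxK -{1}[A]submxK mulmx_block block_mxKdr Tdl mul0mx add0r.
Qed.

(** On vectors [(w, 0)] the upper triangular [T] acts as its leading block, so
    this block inherits the lower bound satisfied by [T]. *)
Lemma sigma_blockA_mul k n l j (T : 'M[R]_k) (A : 'M[R]_(k, n)) (a : R) :
  (l <= k <= n)%N -> (0 < j)%N -> 0 <= a ->
  is_trig_mx T^T -> is_trig_mx A^T ->
  (forall v, sqnorm v <= a ^+ 2 * sqnorm (T *m v)) ->
  sigma j (blockA A l) <= a * sigma j (blockA (T *m A) l).
Proof.
case/andP=> lk kn j0 a0; rewrite /blockA.
have [p kE] : exists p, (k = l + p)%N by exists (k - l)%N; rewrite subnKC.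
have [q nE] : exists q, (n = l + q)%N.
  by exists (n - l)%N; rewrite subnKC // (leq_trans lk).
subst k n => Ttrig Atrig aT; rewrite blockA_mul //; apply: sigma_le => // v.
rewrite -mulmxA; move: (_ *m v) => w.
have := aT (col_mx w 0); rewrite sqnorm_col_mx.
rewrite -[T in sqnorm (T *m _)]submxK (upper_trapezoidal_dl Ttrig) mul_block_col.
by rewrite !mulmx0 mul0mx !addr0 sqnorm_col_mx !sqnorm0 !addr0.
Qed.

(** The trailing block of [T] maps [w] to the last entries of [T (0, w)], so it
    inherits the upper bound satisfied by [T]. *)
Lemma sigma_blockC_mul k n l j (T : 'M[R]_k) (A : 'M[R]_(k, n)) (a : R) :
  (l <= k <= n)%N -> (0 < j)%N -> 0 <= a ->
  is_trig_mx T^T ->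
  (forall v, sqnorm (T *m v) <= a ^+ 2 * sqnorm v) ->
  sigma j (blockC (T *m A) l) <= a * sigma j (blockC A l).
Proof.
case/andP=> lk kn j0 a0; rewrite /blockC.
have kE : k = (l + (k - l))%N by rewrite subnKC.
have nE : n = (l + (n - l))%N by rewrite subnKC // (leq_trans lk).
move: (k - l)%N (n - l)%N kE nE => p q kE nE.
subst k n => Ttrig aT; rewrite blockC_mul //; apply: sigma_le => // v.
rewrite -mulmxA; move: (_ *m v) => w.
have := aT (col_mx 0 w); rewrite sqnorm_col_mx.
rewrite -[T in sqnorm (T *m _)]submxK (upper_trapezoidal_dl Ttrig) mul_block_col.
rewrite !mulmx0 !add0r !sqnorm_col_mx.
rewrite sqnorm0 add0r; apply: le_trans.
by rewrite lerDr sqnorm_ge0.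
Qed.

End Slices.

(** * Preconditioned matrix *)

Section Preconditioning.
Variable R : realType.

Lemma injective_unitmx n (A : 'M[R]_n) :
  (forall v : 'cV[R]_n, A *m v = 0 -> v = 0) -> A \in unitmx.
Proof.
move=> Ainj; rewrite -row_free_unit /row_free eqn_leq rank_leq_row leqNgt.
by apply/negP => /exists_ker_vec[v v0 /Ainj vE]; rewrite vE eqxx in v0.
Qed.

Lemma sketch_inj m n d p (M : 'M[R]_(m, n)) (S : 'M[R]_(d, m))
    (Z : 'M[R]_(n, p)) :
  (forall v : 'cV[R]_n, S *m (M *m v) = 0 -> M *m v = 0) ->
  S *m (M *m Z) = 0 -> M *m Z = 0.
Proof.
move=> Sinj SMZ; apply/matrixP=> i j.
have /matrixP/(_ i 0) : M *m (Z *m (delta_mx j 0 : 'cV_p)) = 0.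
  by apply: Sinj; rewrite (mulmxA M) mulmxA SMZ mul0mx.
by rewrite mulmxA -colE !mxE.
Qed.

Lemma rank_sketch m n d (M : 'M[R]_(m, n)) (S : 'M[R]_(d, m)) :
  (forall v : 'cV[R]_n, S *m (M *m v) = 0 -> M *m v = 0) ->
  \rank (S *m M) = \rank M.
Proof.
move=> Sinj; apply/eqP; rewrite eqn_leq mxrankM_maxr mxrankS // submxE.
by apply/eqP/(sketch_inj Sinj); rewrite mulmxA mulmx_coker.
Qed.

Definition preconditioned m n k (M : 'M[R]_(m, n)) (A : 'M[R]_(k, n)) (J : 'S_n)
    (r : nat) : 'M[R]_(m, r) :=
  mxslice (col_perm J M) 0 m 0 r *m invmx (mxslice A 0 r 0 r).

Lemma preconditioned_range m n k (M : 'M[R]_(m, n)) (A : 'M[R]_(k, n)) J :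
  (k <= n)%N -> exists Z, preconditioned M A J k = M *m Z.
Proof.
move=> kn; rewrite /preconditioned mxslice_pid // col_permE -!mulmxA.
by eexists.
Qed.

Lemma sketch_preconditioned m n d k (M : 'M[R]_(m, n)) (S : 'M[R]_(d, m)) J
    (Q : 'M[R]_(d, k)) (A : 'M[R]_(k, n)) :
  (k <= n)%N -> mxslice A 0 k 0 k \in unitmx ->
  col_perm J (S *m M) = Q *m A -> S *m preconditioned M A J k = Q.
Proof.
move=> kn Au SMJ; rewrite /preconditioned (mxslice_pid (col_perm J M)) //.
rewrite col_permE !mulmxA -col_permE SMJ.
by rewrite -(mulmxA Q) -mxslice_pid // mulmxK.
Qed.

(** Both sides have their columns in the range of [M], where [S] is injective,
    and they have the same sketch. *)
Lemma preconditioned_factor m n d k (M : 'M[R]_(m, n)) (S : 'M[R]_(d, m)) J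
    (Q : 'M[R]_(d, k)) (A : 'M[R]_(k, n)) :
  (forall v : 'cV[R]_n, S *m (M *m v) = 0 -> M *m v = 0) ->
  (k <= n)%N -> mxslice A 0 k 0 k \in unitmx ->
  col_perm J (S *m M) = Q *m A -> col_perm J M = preconditioned M A J k *m A.
Proof.
move=> Sinj kn Au SMJ; have [Z ZE] := preconditioned_range M A J kn.
apply/eqP; rewrite -subr_eq0 ZE col_permE -mulmxA -mulmxBr; apply/eqP.
apply: (sketch_inj Sinj).
rewrite mulmxBr mulmxBr !mulmxA -col_permE SMJ -(mulmxA S) -ZE.
by rewrite (sketch_preconditioned kn Au SMJ) subrr.
Qed.

(** The part of [cqrrpt_core] that follows the call to [qrcp].  The detected
    rank [r] is separate from the number [k] of rows of [A], although they turn
    out to be equal: the type of the output depends on [r], and with [r] a variable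
    the equality can be substituted. *)
Definition cqrrpt_from m n k (M : 'M[R]_(m, n)) (A : 'M[R]_(k, n)) (J : 'S_n)
    (r : nat) : qr_output R m n :=
  let Mpre := preconditioned M A J r in
  let T := chol (Mpre^T *m Mpre) in
  @QROutput R m n r (Mpre *m invmx T) (T *m mxslice A 0 r 0 n) J.

(** [T] is the Cholesky factor, and it preserves norms up to the distortion of
    [S]: with [B] the preconditioned matrix, [|T v| = |B v|] while
    [|S B v| = |Q v| = |v|]. *)
Lemma cqrrpt_from_spec m n d (M : 'M[R]_(m, n)) (S : 'M[R]_(d, m)) (lo hi : R)
    k (J : 'S_n) (Q : 'M[R]_(d, k)) (A : 'M[R]_(k, n)) :
  0 < lo ->
  (forall v, lo ^+ 2 * sqnorm (M *m v) <= sqnorm (S *m (M *m v))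
                <= hi ^+ 2 * sqnorm (M *m v)) ->
  (k <= n)%N -> k = \rank (S *m M) ->
  mxslice A 0 k 0 k \in unitmx -> orthonormal_mx Q ->
  is_trig_mx A^T -> col_perm J (S *m M) = Q *m A ->
  is_qrcp M (cqrrpt_from M A J k) /\
  exists T : 'M[R]_k, [/\ qr_R (cqrrpt_from M A J k) = T *m A, is_trig_mx T^T
    & forall v, lo ^+ 2 * sqnorm (T *m v) <= sqnorm v
                  <= hi ^+ 2 * sqnorm (T *m v)].
Proof.
move=> lo0 bnd kn kE Au Q1 Atrig SMJ.
have Sinj (v : 'cV[R]_n) : S *m (M *m v) = 0 -> M *m v = 0.
  move=> SMv; apply/eqP; rewrite -sqnorm_eq0 eq_le sqnorm_ge0 andbT.
  have /andP[+ _] := bnd v; rewrite SMv.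
  by rewrite sqnorm0 pmulr_rle0 // exprn_gt0.
have SMpre := sketch_preconditioned kn Au SMJ.
have [Z ZE] := preconditioned_range M A J kn.
have MJ := preconditioned_factor Sinj kn Au SMJ.
rewrite /cqrrpt_from /= mxslice_full.
move: (preconditioned M A J k) SMpre ZE MJ => B SB BE MJ.
have Bv v : sqnorm v = sqnorm (S *m (M *m (Z *m v))).
  by rewrite (mulmxA M) -BE mulmxA SB sqnorm_orthonormal.
have [|Ttrig Tu BT1 TB] := @chol_gram _ _ _ B.
  move=> v Bv0; apply/eqP; rewrite -sqnorm_eq0 Bv (mulmxA M) -BE Bv0 mulmx0.
  by rewrite sqnorm_eq0.
set T := chol _ in Ttrig Tu BT1 TB *; split.
  split=> //=; first by rewrite kE (rank_sketch Sinj).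
    have /is_trig_mxP trT := Ttrig; have /is_trig_mxP trA := Atrig.
    apply/is_trig_mxP => i j ij; rewrite !mxE big1 // => l _.
    have [lj|jl] := ltnP l j; last first.
      by have := trA i l (leq_trans ij jl); rewrite mxE => ->; rewrite mulr0.
    by have := trT l j lj; rewrite mxE => ->; rewrite mul0r.
  by rewrite mulmxA mulmxKV.
exists T; split=> // v.
by have := bnd (Z *m v); rewrite -Bv (mulmxA M) -BE TB.
Qed.

End Preconditioning.

(** * RRQR property *)

Theorem theorem4 (R : realType) (m n d k : nat)
    (M : 'M[R]_(m, n)) (S : 'M[R]_(d, m)) (c : R) (f : nat -> R)
    (qrcp : 'M[R]_(d, n) -> qr_output R d n)
    (hnd : (n <= d)%N) (hdm : (d <= m)%N)
    (hc : restricted_cond S (mxrange M) = c%:E)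
    (hk : k = \rank (S *m M))
    (hqrcp : rrqr_property qrcp (S *m M) k f) :
  rrqr_property (fun X => cqrrpt_core qrcp X S) M k (fun l => c * f l).
Proof.
have [lo [hi [lo0 lohi cE bnd]]] := restricted_cond_bounds hc.
have hi0 : 0 < hi := lt_le_trans lo0 lohi.
have [_ _ f1 qrX rr] := hqrcp.
have alg_M : cqrrpt_core qrcp M S =
    cqrrpt_from M (qr_R (qrcp (S *m M))) (qr_J (qrcp (S *m M)))
      (\rank (qr_R (qrcp (S *m M)))) by [].
rewrite /rrqr_property alg_M.
case: (qrcp (S *m M)) qrX rr => [r Q A J] [+ Q1 Atrig SMJ] rr.
rewrite -[qr_R (QROutput _ _ _)]/A -[qr_J (QROutput _ _ _)]/J => rE.
rewrite /= in Q1 Atrig SMJ rr; have rk : r = k by rewrite hk -rE.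
move: r rk Q A {rE} Q1 Atrig SMJ rr => r -> Q A Q1 Atrig SMJ rr.
have kn : (k <= n)%N by rewrite hk rank_leq_col.
have rA : \rank A = k.
  apply/eqP; rewrite eqn_leq rank_leq_row {1}hk.
  have <- : \rank (Q *m A) = \rank (S *m M).
    by rewrite -SMJ col_permE mxrankMfree // row_free_unit unitmx_perm.
  exact: mxrankM_maxr.
rewrite rA.
(* An upper trapezoidal matrix of full row rank can have a singular leading
   block; here the RRQR bound keeps the smallest singular value of that block
   positive. *)
have Au : mxslice A 0 k 0 k \in unitmx.
  have [k0|k0] := posnP k.
    move: (mxslice A 0 k 0 k); rewrite k0 => B.
    by rewrite unitmxE det_mx00 unitr1.
  have kk : (1 <= k <= k)%N by rewrite k0 leqnn.
  have sk : 0 < sigma k (mxslice A 0 k 0 k).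
    apply: lt_le_trans ((rr k kk).1 k kk).
    apply: divr_gt0; last exact: lt_le_trans ltr01 (f1 _ kk).
    by apply: sigma_rank_gt0; rewrite -hk.
  apply: injective_unitmx => v Av; apply/eqP.
  rewrite -sqnorm_eq0 eq_le sqnorm_ge0 andbT.
  have := sigman_lb (mxslice A 0 k 0 k) v; rewrite Av.
  by rewrite sqnorm0 pmulr_rle0 // exprn_gt0.
have [qrM [T [-> Ttrig Tb]]] :=
  cqrrpt_from_spec lo0 bnd kn hk Au Q1 Atrig SMJ.
have c1 : 1 <= c by rewrite cE ler_pdivlMr ?mul1r.
split=> //.
- exact: leq_trans hnd hdm.
- by have [<- _ _ _] := qrM.
- by move=> l lk; rewrite mulr_ege1 ?f1.
move=> l lk; have fl : 0 < f l by rewrite (lt_le_trans ltr01) ?f1.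
have lkn : (l <= k <= n)%N by case/andP: lk => _ ->.
split=> j jl; have j1 : (0 < j)%N by case/andP: jl.
- have MS : lo * sigma j M <= sigma j (S *m M).
    rewrite -ler_pdivlMl //; apply: sigma_le => // [|v].
      by rewrite invr_ge0 ltW.
    by rewrite exprVn ler_pdivlMl ?exprn_gt0 // -mulmxA; case/andP: (bnd v).
  have AT : sigma j (blockA A l) <= hi * sigma j (blockA (T *m A) l).
    by apply: sigma_blockA_mul => // [|v]; [exact: ltW | case/andP: (Tb v)].
  rewrite ler_pdivrMr ?mulr_gt0 ?(lt_le_trans ltr01 c1) //.
  have := (rr l lk).1 j jl; rewrite ler_pdivrMr // => SA.
  rewrite cE -(ler_pM2l lo0) (le_trans MS) // (le_trans SA) //.
  have -> : lo * (sigma j (blockA (T *m A) l) * (hi / lo * f l)) =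
     hi * sigma j (blockA (T *m A) l) * f l by field; apply: lt0r_neq0.
  by rewrite ler_wpM2r // ltW.
- have SM : sigma (l + j) (S *m M) <= hi * sigma (l + j) M.
    apply: sigma_le => // [||v]; [by rewrite addn_gt0 j1 orbT | exact: ltW |].
    by rewrite -mulmxA; case/andP: (bnd v).
  have TA : sigma j (blockC (T *m A) l) <= lo^-1 * sigma j (blockC A l).
    apply: sigma_blockC_mul => // [|v]; first by rewrite invr_ge0 ltW.
    by rewrite exprVn ler_pdivlMl ?exprn_gt0 //; case/andP: (Tb v).
  apply: le_trans TA _; rewrite ler_pdivrMl //.
  apply: le_trans ((rr l lk).2 j jl) _.
  have -> : lo * (c * f l * sigma (l + j) M) = f l * (hi * sigma (l + j) M).
    by rewrite cE; field; apply: lt0r_neq0.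
  by rewrite ler_wpM2l // ltW.
Qed.
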